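(* For $a\in\mathcal U$ and any $(\mathcal E,\theta)$ in the fiber $h_P^{-1}(a)$, the Jordan blocks of $\theta \bmod t$ (that is, of the nilpotent endomorphism induced by $\theta$ on the fiber $E|_x$) are of sizes $(\mu_1,\mu_2,\dots,\mu_{n_1})$.
   Context: $k$ is an algebraically closed field, $X$ a smooth projective curve over $k$ of genus $g\ge2$, $D=\{x\}$ a single point, $r\ge 1$ an integer (with $r\ge3$ if $\mathrm{char}\,k=2$), $t$ a local coordinate at $x$, and $\omega_X(x)$ is trivialized near $x$ by $dt/t$. Fix positive integers $m^1,\dots,m^\sigma$ with sum $r$ (Levi type). A strongly parabolic Higgs bundle $(\mathcal E,\theta)$ of this type is a rank $r$ vector bundle $E$ on $X$ with a filtration $E|_x=F^0\supset F^1\supset\dots\supset F^\sigma=0$, $\dim F^{j-1}/F^j=m^j$, and an $\mathcal O_X$-linear map $\theta:E\to E\otimes\omega_X(x)$ with $\theta(F^j)\subset F^{j+1}\otimes\omega_X(x)|_x$ for all $j$. Let $n_1\ge\dots\ge n_\sigma$ be the decreasing rearrangement of $(m^j)$, $\mu_i=\#\{\ell:n_\ell\ge i\}$ ($1\le i\le n_1$) the conjugate partition, and for $1\le j\le r$ let $\gamma_j=l$ iff $\sum_{s\le l-1}\mu_s<j\le\sum_{s\le l}\mu_s$. Put $\mathcal H_P=\prod_{j=1}^rH^0\big(X,\omega_X^{\otimes j}\otimes\mathcal O_X((j-\gamma_j)x)\big)$. $h_P$ is the strongly parabolic Hitchin map, sending a (stable, for a fixed generic choice of parabolic weights) strongly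 parabolic Higgs bundle $(\mathcal E,\theta)$ to the coefficients $a=(a_1,\dots,a_r)\in\mathcal H_P$ of its characteristic polynomial $\lambda^r+a_1\lambda^{r-1}+\dots+a_r$. The spectral curve $\pi:X_a\to X$ is cut out by this polynomial in the total space of $\omega_X(x)$. $\mathcal U\subset\mathcal H_P$ is the open subset of those $a$ such that: (0) writing the polynomial near $x$ as $f=\lambda^r+b_1\lambda^{r-1}+\dots+b_r$ with $b_j\in\hat{\mathcal O}_{X,x}=k[[t]]$, each $b_j$ has $t$-valuation exactly $\gamma_j$; (a) $X_a$ is integral and smooth outside $\pi^{-1}(x)$; (b) the Newton polygon of $f$ is non-degenerate: put $N_l=\mu_1+\dots+\mu_l$, $b_0=1$, and let $\bar b_{N_l}\in k$ be the coefficient of $t^l$ in $b_{N_l}$; for each value $\mu$ occurring in the conjugate partition, say exactly for the indices $i=l_0+1,\dots,l_1$, the one-variable polynomial $\sum_{l=l_0}^{l_1}\bar b_{N_l}u^{l_1-l}$ (which encodes the part of $f$ supported on the corresponding edge, with $u=\lambda^{\mu}/t$) has pairwise distinct nonzero roots. *)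

(* Defs.v *)
From HB Require Import structures.
From mathcomp Require Import all_boot all_order all_algebra.
From mathcomp Require Import boolp classical_sets reals.

Set Implicit Arguments.
Unset Strict Implicit.
Unset Printing Implicit Defensive.

Import Order.TTheory GRing.Theory Num.Theory.
Local Open Scope ring_scope.

(* Smooth projective curves are encoded classically, through their function
   fields: over an algebraically closed field k, a smooth projective (connected)
   curve is the same thing as a function field K/k of one variable, its closed
   points being the discrete valuations of K trivial on k, and its local rings
   the corresponding valuation rings.  *)

Definition is_function_field (k K : fieldType) (iota : {rmorphism k -> K}) :=
  exists z : K,
    (forall q : {poly k}, q != 0 -> (map_poly iota q).[z] != 0) /\
    exists (n : nat) (b : 'I_n -> K), forall y : K,
      exists (q : {poly k}) (c : 'I_n -> {poly k}),
        q != 0 /\ (map_poly iota q).[z] * y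
                  = \sum_(i < n) (map_poly iota (c i)).[z] * b i.

Record curve (k : closedFieldType) := Curve {
  ratfun :> fieldType;
  kconst : {rmorphism k -> ratfun};
  curveP : is_function_field kconst }.

(* A closed point is a normalized discrete valuation; the value at 0, which
   would be +oo, is set to the dummy value 0.  *)
Record closed_point (k : closedFieldType) (X : curve k) := ClosedPoint {
  ord : X -> int;
  ord0 : ord 0 = 0;
  ordM : forall y z : X, y != 0 -> z != 0 -> ord (y * z) = ord y + ord z;
  ordD : forall y z : X, y != 0 -> z != 0 -> y + z != 0 ->
    Num.min (ord y) (ord z) <= ord (y + z);
  ordC : forall c : k, ord (kconst X c) = 0;
  ord_surj : exists t : X, ord t = 1 }.

HB.instance Definition _ k (X : curve k) := gen_eqMixin (closed_point X).
HB.instance Definition _ k (X : curve k) := gen_choiceMixin (closed_point X).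

(* y belongs to the n-th power (n in Z) of the maximal ideal of O_{X,p} *)
Definition ord_ge k (X : curve k) (p : closed_point X) (n : int)
    (y : X) : bool :=
  (y == 0) || (n <= ord p y).

Definition is_derivation k (X : curve k) (M : lmodType X) (D : X -> M) :=
  [/\ forall y z, D (y + z) = D y + D z,
      forall y z, D (y * z) = y *: D z + z *: D y
    & forall c : k, D (kconst X c) = 0].

(* The module of Kaehler differentials of K/k, that is, the rational
   differential forms on X.  *)
Record differentials k (X : curve k) := Differentials {
  form :> lmodType X;
  dif : X -> form;
  dif_derivation : is_derivation dif;
  dif_universal : forall (M : lmodType X) (D : X -> M), is_derivation D ->
    exists phi : {linear form -> M},
      (forall y, D y = phi (dif y)) /\
      forall psi : {linear form -> M},
        (forall y, D y = psi (dif y)) -> phi =1 psi }.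

(* The stalk of omega_X at p: a rational form is regular at p when its
   coefficient in every local coordinate s at p is regular.  *)
Definition regular_form k (X : curve k) (Om : differentials X)
    (p : closed_point X) (w : Om) :=
  forall s : X, ord p s = 1 -> exists2 f : X, ord_ge p 0 f & w = f *: dif Om s.

Definition is_genus k (X : curve k) (Om : differentials X) (g : nat) :=
  exists w : 'I_g -> Om,
    (forall i p, regular_form p (w i)) /\
    forall eta : Om, (forall p, regular_form p eta) ->
      exists! c : {ffun 'I_g -> k}, eta = \sum_(i < g) kconst X (c i) *: w i.

(* From here on x is the marked point and t a local coordinate at x.  Rational
   sections of omega_X^j (j in Z) are written y (dt)^j or y (dt/t)^j, and are
   identified with y : K.  *)

(* l (dt) generates the stalk of omega_X at p *)
Definition omega_gen k (X : curve k) (Om : differentials X) (t : X)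
    (p : closed_point X) (l : X) :=
  l != 0 /\
  forall y : X, regular_form p (y *: dif Om t) <-> ord_ge p 0 (y / l).

(* y (dt/t)^j belongs to the stalk at p of omega_X^j \otimes O_X(n x) *)
Definition sect k (X : curve k) (Om : differentials X) (x : closed_point X)
    (t : X) (j n : int) (p : closed_point X) (y : X) :=
  exists2 l : X, omega_gen Om t p l &
    ord_ge p (if p == x then - n else 0) (y * t ^ (- j) / l ^ j).

(* l (dt/t) generates the stalk of omega_X(x) at p *)
Definition logomega_gen k (X : curve k) (Om : differentials X)
    (x : closed_point X) (t : X) (p : closed_point X) (l : X) :=
  l != 0 /\ forall y : X, sect Om x t 1 1 p y <-> ord_ge p 0 (y / l).

(* m lists the m^j, and conj_partition m the mu_i, from index 0 on. *)
Definition conj_partition (m : seq nat) : seq nat :=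
  let n := sort geq m in
  [seq count (leq i) n | i <- iota 1 (head 0%N n)].

Definition partial_sum (mu : seq nat) (l : nat) : nat := sumn (take l mu).

Definition gamma (mu : seq nat) (j : nat) : nat :=
  find (fun l => j <= partial_sum mu l)%N (iota 0 (size mu).+1).

Lemma leq_partial_sum mu l l' :
  (l <= l')%N -> (partial_sum mu l <= partial_sum mu l')%N.
Proof.
move=> le_ll'; rewrite /partial_sum -(subnKC le_ll') takeD sumn_cat.
exact: leq_addr.
Qed.

Lemma gammaP mu j l : (0 < j <= sumn mu)%N ->
  gamma mu j = l <->
  [/\ (0 < l)%N, (partial_sum mu l.-1 < j)%N & (j <= partial_sum mu l)%N].
Proof.
case/andP=> j_gt0 j_le; pose P l := (j <= partial_sum mu l)%N.
have has_j : has P (iota 0 (size mu).+1).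
  apply/hasP; exists (size mu); first by rewrite mem_iota /= ltnS.
  by rewrite /P /partial_sum take_size.
have lt_g : (gamma mu j < (size mu).+1)%N.
  by move: has_j; rewrite has_find size_iota.
have P_g : P (gamma mu j).
  by have := nth_find 0%N has_j; rewrite -/(gamma mu j) nth_iota ?add0n.
have nP_lt i : (i < gamma mu j)%N -> ~~ P i.
  move=> lt_i; have := @before_find _ 0%N P _ _ lt_i.
  by rewrite nth_iota ?add0n ?(ltn_trans lt_i) // => ->.
split=> [<-|[l_gt0 lt_j le_j]].
  have g_gt0 : (0 < gamma mu j)%N.
    by rewrite lt0n; apply: contraTneq P_g => ->; rewrite /P /partial_sum take0
      -ltnNge.
  by split=> //; rewrite ltnNge; apply: nP_lt; rewrite prednK.
apply/eqP; rewrite eqn_leq; apply/andP; split.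
  by rewrite leqNgt; apply: contraL le_j => /nP_lt.
rewrite leqNgt; apply/negP=> lt_gl; move: lt_j; rewrite ltnNge => /negP; apply.
by apply: leq_trans P_g (leq_partial_sum _ _); rewrite -ltnS prednK.
Qed.

(* a = (a_1, ..., a_r) is given by the coordinates b_j of a_j = b_j (dt/t)^j; by
   convention b_0 = 1, so that b_j is the j-th item of 1 :: a.  *)

Definition in_HP k (X : curve k) (Om : differentials X) (x : closed_point X)
    (t : X) (r : nat) (mu : seq nat) (a : r.-tuple X) :=
  forall (j : nat) (p : closed_point X), (0 < j <= r)%N ->
    sect Om x t j%:Z (j%:Z - (gamma mu j)%:Z) p (1 :: a)`_j.

(* c is the power series expansion of y in k[[t]], the completion of O_{X,x} *)
Definition is_expansion k (X : curve k) (x : closed_point X) (t : X) (y : X)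
    (c : nat -> k) :=
  forall n : nat, ord_ge x n%:Z (y - \sum_(i < n) kconst X (c i) * t ^+ i).

Definition has_valuation (k : fieldType) (c : nat -> k) (n : nat) :=
  (forall i, (i < n)%N -> c i = 0) /\ c n != 0.

Definition distinct_nonzero_roots (k : fieldType) (q : {poly k}) :=
  q != 0 /\ exists s : seq k,
    [/\ uniq s, 0 \notin s & q = lead_coef q *: \prod_(c <- s) ('X - c%:P)].

(* b j is the expansion of b_j; l0, l1 delimit the indices i (shifted by one)
   for which mu_i = v.  *)
Definition newton_nondegenerate (k : fieldType) (mu : seq nat)
    (b : nat -> nat -> k) :=
  forall (v l0 l1 : nat), (l0 < l1 <= size mu)%N ->
    (forall i, (i < size mu)%N -> (nth 0%N mu i == v) = (l0 <= i < l1)%N) ->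
    distinct_nonzero_roots
      (\sum_(l0 <= l < l1.+1) b (partial_sum mu l) l *: 'X^(l1 - l)).

Definition spectral_poly k (X : curve k) (r : nat) (a : r.-tuple X) :
    {poly X} :=
  \sum_(j < r.+1) (1 :: a)`_j *: 'X^(r - j).

(* Tot = total space of omega_X(x), S = a finite set of points, U = X \ S.
   A polynomial h = sum_i h_i lambda^i, with coefficients trivialized by powers
   of dt/t, is a section over Tot|_U of the pullback of omega_X(x)^n.  *)
Definition tot_section k (X : curve k) (Om : differentials X)
    (x : closed_point X) (t : X) (n : int)
    (S : seq (closed_point X)) (h : {poly X}) :=
  forall (p : closed_point X) (i : nat), p \notin S ->
    sect Om x t (n - i%:Z) (n - i%:Z) p h`_i.

(* The ideal of X_a in the ring of functions on Tot|_U *)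
Definition spectral_ideal k (X : curve k) (Om : differentials X)
    (x : closed_point X) (t : X) (r : nat) (a : r.-tuple X)
    (S : seq (closed_point X)) (h : {poly X}) :=
  exists2 q : {poly X},
    tot_section Om x t (- r%:Z) S q & h = spectral_poly a * q.

(* The affine opens X \ S, S finite and nonempty, form a base of neighborhoods
   of the points of X; X_a is integral when the coordinate rings of its affine
   opens over them are domains.  *)
Definition spectral_integral k (X : curve k) (Om : differentials X)
    (x : closed_point X) (t : X) (r : nat) (a : r.-tuple X) :=
  forall S : seq (closed_point X), (0 < size S)%N ->
    ~ spectral_ideal Om x t a S 1 /\
    forall h1 h2 : {poly X},
      tot_section Om x t 0 S h1 -> tot_section Om x t 0 S h2 ->
      spectral_ideal Om x t a S (h1 * h2) ->
      spectral_ideal Om x t a S h1 \/ spectral_ideal Om x t a S h2.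

(* The equation of X_a in the fibre coordinate u = lambda / (l dt/t) *)
Definition local_spectral_poly k (X : curve k) (r : nat) (a : r.-tuple X)
    (l : X) : {poly X} :=
  \sum_(j < r.+1) ((1 :: a)`_j / l ^+ j) *: 'X^(r - j).

(* Smoothness at every closed point (p, u = c) with p <> x, by the Jacobian
   criterion: since c is constant, the derivative of the equation along the base
   vanishes at (p, c) iff its value at u = c has order >= 2 at p.  *)
Definition spectral_smooth_outside k (X : curve k) (Om : differentials X)
    (x : closed_point X) (t : X) (r : nat) (a : r.-tuple X) :=
  forall (p : closed_point X) (l : X) (c : k), p != x ->
    logomega_gen Om x t p l ->
    let f := local_spectral_poly a l in
    ord_ge p 1 f.[kconst X c] ->
    ~~ (ord_ge p 1 f^`().[kconst X c] && ord_ge p 2 f.[kconst X c]).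

Definition in_U k (X : curve k) (Om : differentials X) (x : closed_point X)
    (t : X) (r : nat) (mu : seq nat) (a : r.-tuple X) :=
  [/\ in_HP Om x t mu a,
      exists b : nat -> nat -> k,
        [/\ forall j, (j <= r)%N -> is_expansion x t (1 :: a)`_j (b j),
            forall j, (0 < j <= r)%N -> has_valuation (b j) (gamma mu j)
          & newton_nondegenerate mu b],
      spectral_integral Om x t a
    & spectral_smooth_outside Om x t a].

Definition is_frame k (X : curve k) (V : vectType X)
    (stalk : closed_point X -> set V) (n : nat) (p : closed_point X)
    (W : {vspace V}) (e : n.-tuple V) :=
  basis_of W e /\
  forall v : V, v \in W -> stalk p v <-> forall i, ord_ge p 0 (coord e i v).

(* A vector bundle is given by its generic fibre V, together with its stalks in
   V, which have to be locally simultaneously trivial.  *)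
Record bundle k (X : curve k) (r : nat) := Bundle {
  gfib : vectType X;
  stalk : closed_point X -> set gfib;
  bundle_rank : \dim {:gfib} = r;
  bundle_trivial : forall p : closed_point X,
    exists (S : seq (closed_point X)) (e : r.-tuple gfib),
      p \notin S /\ forall q, q \notin S -> is_frame stalk q fullv e }.

(* The subspaces W of the generic fibre of E correspond to the subbundles of E,
   with stalks W :&: stalk p.  The degree of such a subbundle is the degree of
   the divisor of the rational section e_1 /\ ... /\ e_n of its determinant, for
   any basis e of W.  *)
Definition is_degree k (X : curve k) r (E : bundle X r) (W : {vspace gfib E})
    (d : int) :=
  exists (e : (\dim W).-tuple (gfib E))
         (b : closed_point X -> (\dim W).-tuple (gfib E))
         (S : seq (closed_point X)),
    let div p := ord p (\det (\matrix_(i, j) coord (b p) j e`_i)) in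
    [/\ basis_of W e, forall p, is_frame (@stalk _ _ _ E) p W (b p),
        uniq S, forall p, p \notin S -> div p = 0
      & d = \sum_(p <- S) div p].

Definition degree k (X : curve k) r (E : bundle X r) (W : {vspace gfib E}) :
  int := xget 0 [set d | is_degree W d]%classic.

(* ev realizes the k-vector space Fx as the fibre at x, stalk x / t stalk x, of
   E (only the values of ev on stalk x matter).  *)
Definition is_fibre k (X : curve k) (x : closed_point X)
    (t : X) r (E : bundle X r) (Fx : vectType k) (ev : gfib E -> Fx) :=
  [/\ forall u v, stalk x u -> stalk x v -> ev (u + v) = ev u + ev v,
      forall (y : X) (c : k) v, ord_ge x 1 (y - kconst X c) -> stalk x v ->
        ev (y *: v) = c *: ev v,
      forall w, exists2 v, stalk x v & ev v = w
    & forall v, stalk x v -> ev v = 0 <-> stalk x (t^-1 *: v)].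

(* hmap is the Higgs field theta written as v |-> hmap v \otimes dt/t on the
   generic fibre, and hres the endomorphism that it induces on the fibre at x, where
   omega_X(x) is trivialized by dt/t.  *)
Record higgs k (X : curve k) (Om : differentials X) (x : closed_point X) (t : X)
    (r : nat) (m : seq nat) := Higgs {
  hbun : bundle X r;
  fibre : vectType k;
  ev : gfib hbun -> fibre;
  ev_fibre : is_fibre x t ev;
  flag : nat -> {vspace fibre};
  flag0 : flag 0 = fullv;
  flag_size : flag (size m) = 0%VS;
  flag_sub : forall j, (j < size m)%N -> (flag j.+1 <= flag j)%VS;
  flag_dim : forall j, (j < size m)%N ->
    \dim (flag j) = (\dim (flag j.+1) + nth 0%N m j)%N;
  hmap : 'End(gfib hbun);
  hmap_regular : forall p v, stalk p v ->
    exists2 l, logomega_gen Om x t p l & stalk p (l^-1 *: hmap v);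
  hres : 'End(fibre);
  hres_induced : forall v, stalk x v -> hres (ev v) = ev (hmap v);
  hres_strongly_parabolic : forall j, (j < size m)%N ->
    (hres @: flag j <= flag j.+1)%VS }.

Section Stability.
Context (k : closedFieldType) (X : curve k) (Om : differentials X).
Context (x : closed_point X) (t : X) (r : nat) (m : seq nat) (R : realType).
Implicit Types (H : higgs Om x t r m) (alpha : 'I_(size m) -> R).

(* alpha j is the weight of F^j / F^(j+1) *)
Definition is_weights alpha :=
  (forall j, 0 <= alpha j < 1) /\
  forall i j : 'I_(size m), (i < j)%N -> alpha i < alpha j.

(* The fibre at x of the subbundle W, as a subspace of the fibre of E *)
Definition sub_fibre H (W : {vspace gfib (hbun H)}) : {vspace fibre H} :=
  xget 0%VS [set G : {vspace fibre H} |
    forall w, w \in G <-> exists v, [/\ v \in W, stalk x v & ev v = w]]%classic.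

Definition pardeg alpha H (W : {vspace gfib (hbun H)}) : R :=
  (degree W)%:~R + \sum_(j < size m) alpha j *
    (\dim (sub_fibre W :&: flag H j) - \dim (sub_fibre W :&: flag H j.+1))%:R.

Definition stable alpha H :=
  forall W : {vspace gfib (hbun H)}, W != 0%VS -> W != fullv ->
    (hmap H @: W <= W)%VS ->
    pardeg alpha W / (\dim W)%:R < pardeg alpha {:gfib (hbun H)} / r%:R.

Definition semistable alpha H :=
  forall W : {vspace gfib (hbun H)}, W != 0%VS -> W != fullv ->
    (hmap H @: W <= W)%VS ->
    pardeg alpha W / (\dim W)%:R <= pardeg alpha {:gfib (hbun H)} / r%:R.

Definition hdegree H : int := degree {:gfib (hbun H)}.

(* Generic weights, for bundles of degree d: no strictly semistable objects *)
Definition is_generic alpha (d : int) :=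
  forall H, hdegree H = d -> semistable alpha H -> stable alpha H.

Definition hitchin H : r.-tuple X :=
  let e := vbasis {:gfib (hbun H)} in
  [tuple (char_poly (passmx.mxof e e (hmap H)))`_(r - i.+1) | i < r].

End Stability.

(* The Jordan blocks of the nilpotent endomorphism N are of sizes s: there is a
   basis made of the chains e_i, N e_i, ..., N^(s_i - 1) e_i, with
   N^(s_i) e_i = 0.  *)
Definition nilpotent_jordan_blocks (k : fieldType) (V : vectType k)
    (N : 'End(V)) (s : seq nat) :=
  exists e : nat -> V,
    basis_of fullv
      (flatten [seq [seq iter a N (e i) | a <- iota 0 (nth 0%N s i)]
               | i <- iota 0 (size s)]) /\
    forall i, (i < size s)%N -> iter (nth 0%N s i) N (e i) = 0.

(* Main.v *)
Require Import Defs.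
From mathcomp Require Import all_boot all_order all_algebra.
From mathcomp Require Import reals.
From mathcomp Require Import perm zify.

Set Implicit Arguments.
Unset Strict Implicit.
Unset Printing Implicit Defensive.

Import Order.TTheory GRing.Theory Num.Theory.
Local Open Scope ring_scope.

(** Let N be the endomorphism of E|_x induced by theta, nu_1 >= nu_2 >= ... the
    sizes of its Jordan blocks, and mu the conjugate partition of m.  Both are
    partitions of r, and nu = mu follows from the equality of the partial sums
    nu_1 + ... + nu_l and mu_1 + ... + mu_l for all l <= n_1.

    The flag bounds nu from above.  Let c = mu_l, which is the number of the
    m^j that are at least l.  As N maps F^(j-1) into F^j, the rank of N^c is at
    most the sum of the m^j smaller than l (parabolic_rank_le), and this sum
    is mu_1 + ... + mu_l - l c (partial_sum_conj).  On the other hand, the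
    rank of N^c is at least nu_1 + ... + nu_l - l c (jordan_basis_rank_ge).
    Therefore nu_1 + ... + nu_l <= mu_1 + ... + mu_l.

    The spectral curve bounds nu from below.  By Nakayama's lemma a Jordan
    basis of N lifts to a basis of the stalk of E at x (lift_frame), in which
    the matrix of theta is J + t B, with J the Jordan matrix of N and B regular
    at x.
    Up to sign, a_j is the sum of the principal minors of size j of this
    matrix.  In each term of the minor on a set I of indices, every block met
    by I provides a factor divisible by t, because the next vector of the block
    is not available to the last index of I in that block.  Hence t^n divides
    the minor, where n is the number of blocks met by I (char_poly_coef_ord).
    For j = mu_1 + ... + mu_l the valuation of a_j is gamma_j = l, so that some
    I with j elements meets at most l blocks, and j <= nu_1 + ... + nu_l. *)

(** * Jordan bases of nilpotent endomorphisms *)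

(** A chain is encoded by its length and its first vector. *)
Definition jordan_chain (k : fieldType) (V : vectType k) (N : 'End(V))
    (c : nat * V) : seq V :=
  [seq iter a N c.2 | a <- iota 0 c.1].

Definition is_jordan_basis (k : fieldType) (V : vectType k) (N : 'End(V))
    (W : {vspace V}) (cs : seq (nat * V)) :=
  [/\ all (fun c => 0 < c.1)%N cs,
      basis_of W (flatten [seq jordan_chain N c | c <- cs])
    & forall c, c \in cs -> iter c.1 N c.2 = 0].

Section NilpotentJordan.
Context (k : fieldType) (V : vectType k) (N : 'End(V)).
Implicit Types (W U : {vspace V}) (cs : seq (nat * V)) (c : nat * V).

Lemma subseq_free (s1 s2 : seq V) : subseq s1 s2 -> free s2 -> free s1.
Proof.
move=> s12 fs2; have /(subseq_uniqP (free_uniq fs2)) -> := s12.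
exact: filter_free.
Qed.

Lemma free_size_dim (s : seq V) W :
  free s -> {subset s <= W} -> (size s <= \dim W)%N.
Proof. by move=> fs sW; rewrite -(eqnP fs); apply/dimvS/span_subvP. Qed.

Lemma shape_jordan_chains cs :
  shape [seq jordan_chain N c | c <- cs] = [seq c.1 | c <- cs].
Proof.
by rewrite /shape -map_comp; apply: eq_map => c; rewrite /= size_map size_iota.
Qed.

Lemma size_jordan_chains cs :
  size (flatten [seq jordan_chain N c | c <- cs]) = sumn [seq c.1 | c <- cs].
Proof. by rewrite size_flatten shape_jordan_chains. Qed.

Lemma mem_jordan_chains cs c a : c \in cs -> (a < c.1)%N ->
  iter a N c.2 \in flatten [seq jordan_chain N c | c <- cs].
Proof.
move=> c_cs lt_a; apply/flattenP; exists (jordan_chain N c).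
  exact: map_f.
by apply/mapP; exists a => //; rewrite mem_iota.
Qed.

Lemma subseq_flatten_map (T S : eqType) (f g : T -> seq S) (s : seq T) :
  {in s, forall x, subseq (f x) (g x)} ->
  subseq (flatten (map f s)) (flatten (map g s)).
Proof.
elim: s => //= y s IH fg; apply: cat_subseq.
  by apply: fg; rewrite mem_head.
by apply: IH => z zs; apply: fg; rewrite inE zs orbT.
Qed.

Lemma jordan_chain_suffix c n :
  subseq [seq iter a N c.2 | a <- iota n (c.1 - n)] (jordan_chain N c).
Proof.
rewrite map_subseq //; have [le_n|lt_n] := leqP n c.1; last first.
  by rewrite (eqP (ltnW lt_n : c.1 - n == 0)%N) sub0seq.
by rewrite -{2}(subnKC le_n) iotaD add0n suffix_subseq.
Qed.

Lemma jordan_tails_free W cs n : is_jordan_basis N W cs ->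
  free (flatten [seq [seq iter a N c.2 | a <- iota n (c.1 - n)] | c <- cs]).
Proof.
case=> _ /basis_free fr _; apply: subseq_free fr.
by apply: subseq_flatten_map => c _; apply: jordan_chain_suffix.
Qed.

Lemma iter_limg_mem n U u : u \in U -> iter n N u \in iter n (lfun_img N) U.
Proof. by move=> uU; elim: n => //= n IH; apply: memv_img. Qed.

Lemma iter_limg_sub n U : (N @: U <= U)%VS -> (iter n (lfun_img N) U <= U)%VS.
Proof.
move=> NU; elim: n => [|n IH] /=; first exact: subvv.
by apply: subv_trans NU; apply: limgS.
Qed.

Lemma iter_limgS n U W : (U <= W)%VS ->
  (iter n (lfun_img N) U <= iter n (lfun_img N) W)%VS.
Proof. by move=> UW; elim: n => //= n IH; apply: limgS. Qed.

(** The vectors N^a v with a >= n in the chains of a Jordan basis are linearly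
    independent and lie in the image of N^n. *)
Lemma jordan_basis_rank_ge cs n : is_jordan_basis N fullv cs ->
  (sumn [seq c.1 - n | c <- cs] <= \dim (iter n (lfun_img N) fullv))%N.
Proof.
move=> jb; have fr := jordan_tails_free n jb.
have -> : sumn [seq (c.1 - n)%N | c <- cs]
  = size (flatten [seq [seq iter a N c.2 | a <- iota n (c.1 - n)] | c <- cs]).
  rewrite size_flatten /shape -map_comp; congr sumn.
  by apply: eq_map => c; rewrite /= size_map size_iota.
apply: free_size_dim fr _ => v /flattenP [s /mapP[c _ ->] /mapP[a]].
rewrite mem_iota => /andP[le_n _] ->.
by rewrite -(subnKC le_n) iterD; apply: iter_limg_mem; apply: memvf.
Qed.

(** Induction on the nilpotency exponent: a Jordan basis of N W is turned into
    one of W by extending each chain by a preimage of its first vector, and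
    by adding chains of length 1 that span a complement of ker N :&: N W in
    ker N :&: W.  The resulting family generates W, and the rank formula for N
    bounds its size by dim W, because the last vectors of the chains of N W are
    independent elements of ker N :&: N W. *)
Lemma jordan_basis_exists n W : (N @: W <= W)%VS ->
  {in W, forall w, iter n N w = 0} ->
  exists cs, is_jordan_basis N W cs.
Proof.
elim: n W => [|n IHn] W NW nil.
  exists [::]; split=> //=; suff -> : W = 0%VS by apply: nil_basis.
  by apply/eqP; rewrite -subv0; apply/subvP=> w /nil /= ->; rewrite mem0v.
pose W' := (N @: W)%VS; pose K := (W :&: lker N)%VS.
have [||cs' jb'] := IHn W'; first exact: limgS.
  by move=> w /memv_imgP[u uW ->]; rewrite -iterSr; apply: nil.
have [pos' bas' end'] := jb'.
pose NW_ := (N \o projv W)%VF.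
(* a linear section of N : W -> N W *)
pose lift e := projv W (NW_^-1%VF e).
have liftW e : lift e \in W by apply: memv_proj.
have liftK e : e \in W' -> N (lift e) = e.
  move=> eW'; rewrite -[RHS](@limg_lfunVK _ _ _ NW_) ?comp_lfunE //.
  by rewrite /NW_ limg_comp limg_proj.
have c'W c : c \in cs' -> c.2 \in W'.
  move=> cin; apply: (basis_mem bas'); apply: (@mem_jordan_chains _ c 0) => //.
  exact: (allP pos').
have Niter a e : e \in W' -> iter a.+1 N (lift e) = iter a N e.
  by move=> eW'; rewrite iterSr liftK.
pose gs : seq V := vbasis (K :\: W').
pose cs := [seq (c.1.+1, lift c.2) | c <- cs'] ++ [seq (1%N, g) | g <- gs].
exists cs; split.
- rewrite all_cat; apply/andP; split; apply/allP => c /mapP[u _ ->] //.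
- have spanS v : v \in flatten [seq jordan_chain N c | c <- cs] ->
    v \in <<flatten [seq jordan_chain N c | c <- cs]>>%VS by apply: memv_span.
  set S := span _ in spanS.
  have S1 c a : c \in cs' -> (a <= c.1)%N -> iter a N (lift c.2) \in S.
    move=> cin le_a; apply: spanS.
    apply: (@mem_jordan_chains cs (c.1.+1, lift c.2) a) => //.
    by rewrite mem_cat (map_f (fun c => (c.1.+1, lift c.2))).
  have W'S : (W' <= N @: (S :&: W))%VS.
    rewrite -(span_basis bas'); apply/span_subvP => v.
    move=> /flattenP[s /mapP[c cin ->] /mapP[a]]; rewrite mem_iota => lt_a ->.
    rewrite -Niter ?c'W //; apply: memv_img; rewrite memv_cap S1 ?(ltnW lt_a) //.
    have := subvP (iter_limg_sub a NW) _ (iter_limg_mem a (liftW c.2)); exact.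
  have W'S2 : (W' <= S)%VS.
    rewrite -(span_basis bas'); apply/span_subvP => v.
    move=> /flattenP[s /mapP[c cin ->] /mapP[a]]; rewrite mem_iota => lt_a ->.
    by rewrite -Niter ?c'W // S1.
  have KS : (K <= S)%VS.
    rewrite -(addv_diff_cap K W') subv_add (subv_trans (capvSr _ _) W'S2) andbT.
    rewrite -(span_basis (vbasisP (K :\: W'))); apply/span_subvP => v vg.
    apply: spanS; apply: (@mem_jordan_chains cs (1%N, v) 0) => //.
    by rewrite mem_cat (map_f (fun g => (1%N, g))) ?orbT.
  rewrite basisEdim; apply/andP; split.
    apply/subvP=> w wW; have := subvP W'S _ (memv_img N wW).
    case/memv_imgP=> s; rewrite memv_cap => /andP[sS sW] Nws.
    rewrite -(subrK s w) memvD //; apply: (subvP KS).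
    by rewrite memv_cap memvB // memv_ker linearB /= Nws subrr.
  rewrite size_jordan_chains map_cat sumn_cat -!map_comp.
  have -> : sumn [seq ((fun c => c.1) \o (fun g : V => (1%N, g))) i | i <- gs]
      = \dim (K :\: W').
    rewrite -[RHS](size_tuple (vbasis (K :\: W'))) -/gs.
    by elim: (gs) => //= ? ? ->; rewrite add1n.
  have -> : sumn [seq ((fun c => c.1) \o (fun c => (c.1.+1, lift c.2))) i | i <- cs']
      = (\dim W' + size cs')%N.
    have <- : sumn [seq c.1 | c <- cs'] = \dim W'.
      by rewrite -size_jordan_chains -(size_basis (X := in_tuple _) bas').
    by elim: (cs') => //= ? ? ->; lia.
  (* the last vectors of the chains are independent in K :&: W' *)
  have le_cs' : (size cs' <= \dim (K :&: W'))%N.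
    rewrite -(size_map (fun c => iter c.1.-1 N c.2)).
    apply: free_size_dim.
      apply: subseq_free (basis_free bas').
      rewrite -[X in subseq X _]flatten_seq1 -map_comp.
      apply: subseq_flatten_map => c cin.
      rewrite sub1seq; apply/mapP; exists c.1.-1 => //.
      by rewrite mem_iota /= prednK //; apply: (allP pos').
    move=> _ /mapP[c cin ->]; have c1 := allP pos' _ cin.
    have tW' : iter c.1.-1 N c.2 \in W'.
      by apply: (basis_mem bas'); apply: mem_jordan_chains => //; rewrite prednK.
    rewrite !memv_cap tW' (subvP NW) // memv_ker.
    by have := end' _ cin; rewrite -{1}(prednK c1) iterS => ->; rewrite eqxx.
  have := limg_ker_dim N W; have := dimv_cap_compl K W'.
  by rewrite -/W' -/K; lia.
- move=> c; rewrite mem_cat => /orP[/mapP[e ein ->]|/mapP[v vg ->]] /=.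
    by rewrite -iterS Niter ?c'W //; apply: end'.
  have : v \in (K :\: W')%VS by apply: vbasis_mem.
  by move/(subvP (diffvSl _ _)); rewrite memv_cap memv_ker => /andP[_ /eqP].
Qed.

End NilpotentJordan.

(** In the order of the basis, the matrix of N is thus strictly upper triangular
    inside the blocks and zero outside them, as char_poly_coef_ord requires
    modulo t. *)
Lemma jordan_basis_step (k : fieldType) (V : vectType k) (N : 'End(V)) W cs i :
  is_jordan_basis N W cs ->
  let s := [seq c.1 | c <- cs] in
  let w := flatten [seq jordan_chain N c | c <- cs] in
  (i < sumn s)%N ->
  N w`_i = 0 \/
  [/\ (i.+1 < sumn s)%N, reshape_index s i.+1 = reshape_index s i
    & N w`_i = w`_i.+1].
Proof.
move=> [_ _ end_cs] s w lt_i.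
have shE := shape_jordan_chains N cs.
have wE (b o : nat) : (b < size cs)%N -> (o < nth 0%N s b)%N ->
    w`_(flatten_index s b o) = iter o N (nth (0%N, 0) cs b).2.
  move=> lt_b lt_o; rewrite /w nth_flatten shE -/s.
  rewrite flatten_indexKl // flatten_indexKr //.
  rewrite (nth_map (0%N, 0)) // (nth_map 0%N) ?size_iota ?nth_iota //.
    by rewrite (nth_map (0%N, 0)) in lt_o.
  by rewrite (nth_map (0%N, 0)) in lt_o.
set b := reshape_index s i; set o := reshape_offset s i.
have lt_b : (b < size cs)%N by have := reshape_indexP lt_i; rewrite size_map.
have lt_o : (o < nth 0%N s b)%N by apply: reshape_offsetP.
have iE : i = flatten_index s b o by rewrite reshape_indexK.
have NwE : N w`_i = iter o.+1 N (nth (0%N, 0) cs b).2 by rewrite iE wE.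
have [lt_o1|le_o1] := ltnP o.+1 (nth 0%N s b); [right | left].
  have i1E : i.+1 = flatten_index s b o.+1 by rewrite iE /flatten_index addnS.
  rewrite i1E; split; first exact: flatten_indexP.
    by rewrite flatten_indexKl.
  by rewrite NwE wE.
have oE : o.+1 = (nth (0%N, 0) cs b).1.
  rewrite -[RHS](nth_map _ 0%N (fun c => c.1)) //.
  by apply/eqP; rewrite eqn_leq lt_o.
by rewrite NwE oE end_cs // mem_nth.
Qed.

Lemma jordan_basis_sort (k : fieldType) (V : vectType k) (N : 'End(V)) W cs :
  is_jordan_basis N W cs ->
  exists2 cs', is_jordan_basis N W cs' & sorted geq [seq c.1 | c <- cs'].
Proof.
move=> [pos bas end_cs]; pose le (c d : nat * V) := geq c.1 d.1.
have pcs : perm_eq (sort le cs) cs by rewrite perm_sort.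
exists (sort le cs).
  split; first by rewrite (perm_all _ pcs).
    by rewrite -(perm_basis _ (perm_flatten (perm_map _ pcs))) ?perm_sym // in bas *.
  by move=> c; rewrite mem_sort; apply: end_cs.
by rewrite sorted_map; apply: sort_sorted => c d; apply: leq_total.
Qed.

Lemma nilpotent_jordan_blocksP (k : fieldType) (V : vectType k) (N : 'End(V))
    cs :
  is_jordan_basis N fullv cs -> nilpotent_jordan_blocks N [seq c.1 | c <- cs].
Proof.
move=> [_ bas end_cs]; exists (fun i => (nth (0%N, 0) cs i).2); split; last first.
  move=> i; rewrite size_map => lt_i.
  by rewrite (nth_map (0%N, 0)) //; apply: end_cs; rewrite mem_nth.
congr (basis_of _ (flatten _)) : bas.
rewrite -[in LHS](mkseq_nth (0%N, 0) cs) -map_comp size_map.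
apply/eq_in_map => i; rewrite mem_iota => lt_i /=.
by rewrite /jordan_chain (nth_map (0%N, 0)).
Qed.

(** * Ranks of powers of a strongly parabolic endomorphism *)

Section ParabolicRank.
Context (k : fieldType) (V : vectType k) (N : 'End(V)).
Implicit Types (W U : {vspace V}).

Lemma dim_iter_limg_sub n W U : (W <= U)%VS ->
  (\dim (iter n (lfun_img N) U) + \dim W
     <= \dim (iter n (lfun_img N) W) + \dim U)%N.
Proof.
move=> WU; elim: n => [|n IH] /=; first by rewrite addnC.
set Un := iter n _ U in IH *; set Wn := iter n _ W in IH *.
have := limg_ker_dim N Un; have := limg_ker_dim N Wn.
have : (\dim (Wn :&: lker N) <= \dim (Un :&: lker N))%N.
  by apply: dimvS; apply: capvS; [apply: iter_limgS | apply: subvv].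
lia.
Qed.

(** Induction along the flag: at a step with m^j >= l one factor N is spent to
    pass from F^(j-1) to F^j at no cost, and at the other steps replacing
    F^(j-1) by F^j lowers the dimension of the image by at most m^j.  There are
    exactly count (leq l) m steps of the first kind. *)
Lemma parabolic_rank_le (m : seq nat) (F : nat -> {vspace V}) l :
  F (size m) = 0%VS ->
  (forall j, (j < size m)%N -> (F j.+1 <= F j)%VS) ->
  (forall j, (j < size m)%N -> \dim (F j) = (\dim (F j.+1) + nth 0%N m j)%N) ->
  (forall j, (j < size m)%N -> (N @: F j <= F j.+1)%VS) ->
  (\dim (iter (count (leq l) m) (lfun_img N) (F 0%N))
     <= sumn [seq i <- m | i < l])%N.
Proof.
elim: m F => [|i m IH] F /= Fsz Fsub Fdim FN; first by rewrite Fsz dimv0.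
have {}IH := IH (fun j => F j.+1) Fsz (fun j => Fsub j.+1) (fun j => Fdim j.+1)
  (fun j => FN j.+1).
case: leqP => _.
  rewrite add1n iterSr; apply: leq_trans IH.
  by apply: dimvS; apply: iter_limgS; apply: FN.
have := @dim_iter_limg_sub (count (leq l) m) _ _ (Fsub 0%N isT).
by rewrite (Fdim 0%N isT) add0n /=; lia.
Qed.

Lemma parabolic_nilpotent (s : nat) (F : nat -> {vspace V}) :
  F 0%N = fullv -> F s = 0%VS ->
  (forall j, (j < s)%N -> (N @: F j <= F j.+1)%VS) ->
  forall v, iter s N v = 0.
Proof.
move=> F0 Fs FN v; apply/eqP; rewrite -memv0 -Fs.
suff H j : (j <= s)%N -> iter j N v \in F j by apply: H.
elim: j => [|j IH] lt_j; first by rewrite F0 memvf.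
by rewrite iterS (subvP (FN _ lt_j)) // memv_img // IH // ltnW.
Qed.

Lemma parabolic_dim (m : seq nat) (F : nat -> {vspace V}) :
  F (size m) = 0%VS ->
  (forall j, (j < size m)%N -> \dim (F j) = (\dim (F j.+1) + nth 0%N m j)%N) ->
  \dim (F 0%N) = sumn m.
Proof.
elim: m F => [|i m IH] F /= Fsz Fdim; first by rewrite Fsz dimv0.
have := IH (fun j => F j.+1) Fsz (fun j => Fdim j.+1).
by rewrite (Fdim 0%N isT) /= => ->; rewrite addnC.
Qed.

End ParabolicRank.

(** * Conjugate partitions and partial sums *)

Section Conjugate.
Implicit Types (m : seq nat).

Let maxpart m := head 0%N (sort geq m).

Lemma size_conj_partition m : size (conj_partition m) = maxpart m.
Proof. by rewrite size_map size_iota. Qed.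

Lemma nth_conj_partition m i : (i < size (conj_partition m))%N ->
  nth 0%N (conj_partition m) i = count (leq i.+1) m.
Proof.
rewrite size_conj_partition => lt_i.
rewrite (nth_map 0%N) ?size_iota // nth_iota // add1n.
exact/seq.permP/permEl/perm_sort.
Qed.

Lemma maxpartP m x : x \in m -> (x <= maxpart m)%N.
Proof.
rewrite /maxpart; have : sorted geq (sort geq m).
  by apply: sort_sorted => a b; rewrite /= leq_total.
rewrite -(mem_sort geq); case: (sort geq m) => //= y s.
rewrite (path_sortedE (rev_trans leq_trans)) => /andP[/allP ys _].
by rewrite inE => /predU1P[->|/ys].
Qed.

Lemma conj_partition_gt0 m : all (leq 1) (conj_partition m).
Proof.
apply/(all_nthP 0%N) => i lt_i; rewrite nth_conj_partition //.
rewrite -has_count; apply/hasP; exists (maxpart m).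
  rewrite -(mem_sort geq); move: lt_i; rewrite size_conj_partition /maxpart.
  by case: (sort geq m) => //= y s; rewrite mem_head.
by rewrite -size_conj_partition.
Qed.

Lemma partial_sum_rcons (s : seq nat) l : (l < size s)%N ->
  partial_sum s l.+1 = (partial_sum s l + nth 0%N s l)%N.
Proof.
by move=> lt_l; rewrite /partial_sum (take_nth 0%N lt_l) sumn_rcons.
Qed.

Lemma partial_sum_conj_min m l : (l <= size (conj_partition m))%N ->
  partial_sum (conj_partition m) l = sumn [seq minn i l | i <- m].
Proof.
elim: l => [|l IH] lt_l.
  by rewrite /partial_sum take0; elim: (m) => //= i s <-; rewrite minn0.
rewrite partial_sum_rcons // IH ?(ltnW lt_l) // nth_conj_partition //.
elim: (m) => //= i s; case: (leqP l.+1 i) => /=; lia.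
Qed.

(** Both sides count the cells of the first l + 1 columns of the Young diagram
    with rows m: a row of length at least l + 1 contributes l + 1 cells, and a
    shorter row contributes all its cells. *)
Lemma partial_sum_conj m l : (l < size (conj_partition m))%N ->
  partial_sum (conj_partition m) l.+1
  = (l.+1 * nth 0%N (conj_partition m) l + sumn [seq i <- m | i < l.+1])%N.
Proof.
move=> lt_l; rewrite partial_sum_conj_min // nth_conj_partition //.
elim: (m) => [|i s IH] /=; first by rewrite muln0.
by case: (leqP l.+1 i) => /=; lia.
Qed.

Lemma sumn_conj_partition m : sumn (conj_partition m) = sumn m.
Proof.
rewrite -[X in sumn X = _](take_size (conj_partition m)).
rewrite -/(partial_sum _ _) partial_sum_conj_min // size_conj_partition.
congr sumn; rewrite -[RHS]map_id; apply/eq_in_map => i /maxpartP.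
by move/minn_idPl.
Qed.

Lemma sumn_take_le s l n :
  (partial_sum s l <= l * n + sumn [seq i - n | i <- s])%N.
Proof.
rewrite /partial_sum; elim: s l => [|i s IH] [|l] //=.
by have := IH l; rewrite mulSn; lia.
Qed.

Lemma eq_partition_of_partial_sums (s m : seq nat) :
  all (leq 1) s -> all (leq 1) m -> sumn s = sumn m ->
  (forall l, (l <= size m)%N -> partial_sum s l = partial_sum m l) -> s = m.
Proof.
elim: m s => [|i m IH] [|j s] //=.
- by case/andP=> j_gt0 _ _; lia.
- by move=> _ /andP[i_gt0 _]; lia.
case/andP=> j_gt0 sp /andP[i_gt0 mp] eqs eqp.
have eji : j = i by have := eqp 1%N isT; rewrite /partial_sum /= !take0 /=; lia.
rewrite eji; congr (_ :: _); apply: IH => // [|l le_l]; first by lia.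
by have := eqp l.+1 le_l; rewrite /partial_sum /=; lia.
Qed.

End Conjugate.

Section Blocks.
Implicit Types (nu : seq nat).

(** A decreasing list attains the bound of sumn_take_le at n = nu`_l. *)
Lemma partial_sum_sorted nu l : sorted geq nu ->
  (l.+1 * nth 0%N nu l + sumn [seq i - nth 0%N nu l | i <- nu]
     <= partial_sum nu l.+1)%N.
Proof.
elim: nu l => [|i nu IH] l; first by rewrite nth_nil muln0.
move=> /= srt; have srt' := path_sorted srt.
have le_i : all (geq i) nu.
  by move: srt; rewrite (path_sortedE (rev_trans leq_trans)) => /andP[].
rewrite /partial_sum /=; case: l => [|l] /=.
  have -> : sumn [seq (x - i)%N | x <- nu] = 0%N.
    by elim: (nu) le_i => //= j s IHs /andP[+ /IHs ->]; rewrite -subn_eq0 => /eqP ->.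
  by rewrite take0 /=; lia.
have le_n : (nth 0%N nu l <= i)%N.
  have [lt_l|le_l] := ltnP l (size nu); last by rewrite nth_default.
  exact: (all_nthP 0%N le_i).
by have := IH l srt'; rewrite /partial_sum; lia.
Qed.

Lemma sum_parts_le nu (T : {set 'I_(size nu)}) l : sorted geq nu ->
  (#|T| <= l)%N -> (\sum_(b in T) nth 0%N nu b <= partial_sum nu l)%N.
Proof.
case: l => [|l] srt leT.
  by move: leT; rewrite leqn0 cards_eq0 => /eqP ->; rewrite big_set0.
apply: leq_trans (partial_sum_sorted l srt); set n := nth 0%N nu l.
have -> : sumn [seq (i - n)%N | i <- nu] = (\sum_(b < size nu) (nth 0 nu b - n))%N.
  by rewrite sumnE big_map (big_nth 0%N) big_mkord.
apply: (@leq_trans (\sum_(b in T) (n + (nth 0 nu b - n)))%N).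
  by apply: leq_sum => b _; lia.
rewrite big_split /= sum_nat_const leq_add //; first by rewrite leq_mul2r leT orbT.
by rewrite [X in (_ <= X)%N](bigID (mem T)) /= leq_addr.
Qed.

(** The indices of block b are the nu`_b consecutive integers starting from
    sumn (take b nu). *)
Lemma card_block nu r (sum_nu : sumn nu = r) (b : nat) :
  (#|[set i : 'I_r | reshape_index nu i == b]| <= nth 0%N nu b)%N.
Proof.
set A := [set i | _]; rewrite cardE -(size_map val).
rewrite -(size_iota (sumn (take b nu)) (nth 0%N nu b)).
apply: uniq_leq_size; first by rewrite map_inj_uniq ?enum_uniq //; apply: val_inj.
move=> y /mapP[i]; rewrite mem_enum inE => /eqP ib ->.
have lt_i : (i < sumn nu)%N by rewrite sum_nu.
have := reshape_offsetP lt_i; have := reshape_indexK nu i.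
by rewrite mem_iota /flatten_index ib /=; lia.
Qed.

Lemma card_le_blocks nu r (sum_nu : sumn nu = r)
    (beta : 'I_r -> 'I_(size nu)) (J : {set 'I_r}) :
  (forall i, beta i = reshape_index nu i :> nat) ->
  (#|J| <= \sum_(b in beta @: J) nth 0%N nu b)%N.
Proof.
move=> betaE; rewrite -sum1_card (partition_big_imset beta) /=.
apply: leq_sum => b _; rewrite sum1_card.
apply: leq_trans (card_block sum_nu b); apply/subset_leq_card/subsetP => i.
by case/andP=> _ /eqP <-; rewrite inE betaE.
Qed.

End Blocks.

(** * Orders of the coefficients of a characteristic polynomial *)

Section Valuation.
Context (k : closedFieldType) (X : curve k) (p : closed_point X).
Implicit Types (y z : X) (n : int).

Lemma ord_one : ord p 1 = 0.
Proof. by rewrite -(rmorph1 (kconst X)) ordC. Qed.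

Lemma ordN1 : ord p (-1) = 0.
Proof. by rewrite -(rmorph1 (kconst X)) -rmorphN ordC. Qed.

Lemma ordV y : y != 0 -> ord p y^-1 = - ord p y.
Proof.
move=> y0; apply/eqP; rewrite -addr_eq0 -ordM ?invr_eq0 //.
by rewrite mulVf // ord_one.
Qed.

Lemma ord_ge0 n : ord_ge p n 0.
Proof. by rewrite /ord_ge eqxx. Qed.

Lemma ord_geM n n' y z :
  ord_ge p n y -> ord_ge p n' z -> ord_ge p (n + n') (y * z).
Proof.
rewrite /ord_ge; have [->|y0] := eqVneq y 0; first by rewrite mul0r eqxx.
have [->|z0] := eqVneq z 0; first by rewrite mulr0 eqxx.
by rewrite mulf_eq0 (negPf y0) (negPf z0) /= ordM //; apply: lerD.
Qed.

Lemma ord_geD n y z : ord_ge p n y -> ord_ge p n z -> ord_ge p n (y + z).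
Proof.
rewrite /ord_ge; have [->|y0] := eqVneq y 0; first by rewrite add0r.
have [->|z0] := eqVneq z 0; first by rewrite addr0 (negPf y0).
have [//|yz0] := eqVneq (y + z) 0 => /= ny nz.
by apply: le_trans (ordD p y0 z0 yz0); rewrite le_min ny nz.
Qed.

Lemma ord_ge1 : ord_ge p 0 1.
Proof. by rewrite /ord_ge ord_one lexx orbT. Qed.

Lemma ord_geC c : ord_ge p 0 (kconst X c).
Proof. by rewrite /ord_ge ordC lexx orbT. Qed.

Lemma ord_geN n y : ord_ge p n y -> ord_ge p n (- y).
Proof.
rewrite -mulN1r -[X in ord_ge p X (_ * _)]add0r; apply: ord_geM.
by rewrite /ord_ge ordN1 lexx orbT.
Qed.

Lemma ord_geW n n' y : n <= n' -> ord_ge p n' y -> ord_ge p n y.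
Proof. by rewrite /ord_ge => nn' /orP[-> //|/(le_trans nn') ->]; rewrite orbT. Qed.

Lemma ord_ge_sum n (I : finType) (P : pred I) (F : I -> X) :
  (forall i, P i -> ord_ge p n (F i)) -> ord_ge p n (\sum_(i | P i) F i).
Proof.
move=> FP; elim/big_ind: _ => // [|y z]; first exact: ord_ge0.
exact: ord_geD.
Qed.

Lemma ord_ge_prod (I : finType) (P : pred I) (w : I -> nat) (F : I -> X) :
  (forall i, P i -> ord_ge p (w i)%:Z (F i)) ->
  ord_ge p (\sum_(i | P i) w i)%N%:Z (\prod_(i | P i) F i).
Proof.
move=> FP; elim/big_ind2: _ => // [|a y b z ay bz]; first exact: ord_ge1.
by rewrite PoszD; apply: ord_geM.
Qed.

Lemma ord_ge_det (n : nat) (A : 'M[X]_n) :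
  (forall i j, ord_ge p 0 (A i j)) -> ord_ge p 0 (\det A).
Proof.
move=> A0; apply: ord_ge_sum => s _; rewrite mulr_sign.
have : ord_ge p 0 (\prod_i A i (s i)).
  have := @ord_ge_prod _ predT (fun=> 0%N) (fun i => A i (s i)).
  by rewrite big1 //; apply=> i _.
by case: (odd_perm s) => // /ord_geN.
Qed.

End Valuation.

Section CharPolyValuation.
Context (k : closedFieldType) (X : curve k) (p : closed_point X).

(** The last index of J in a given block cannot be moved forward inside its
    block by a permutation that stabilizes J, hence each block met by J has a
    bad index. *)
Lemma card_moved_blocks n q (beta : 'I_n -> 'I_q) (s : {perm 'I_n})
    (J : {set 'I_n}) (bad : pred 'I_n) :
  (forall i, i \notin J -> s i = i) ->
  (forall i, ~~ bad i -> beta (s i) = beta i /\ (i < s i)%N) ->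
  (#|[set beta i | i in J]| <= #|[set i in J | bad i]|)%N.
Proof.
move=> sJ good; apply: leq_trans (leq_imset_card beta _).
apply/subset_leq_card/subsetP => _ /imsetP[i0 i0J ->].
have P0 : (i0 \in J) && (beta i0 == beta i0) by rewrite i0J eqxx.
case: (@arg_maxnP _ i0 (fun i => (i \in J) && (beta i == beta i0))
  (fun i : 'I_n => i : nat) P0) => i /andP[iJ /eqP bi] imax.
apply/imsetP; exists i => //; rewrite inE iJ /=.
apply/negPn/negP => /good[bs lt_s].
suff siJ : s i \in J.
  have := imax (s i); rewrite siJ bs bi eqxx => /(_ isT).
  by move/(leq_trans lt_s); rewrite ltnn.
apply/negPn/negP => /sJ /perm_inj sii; by rewrite sii ltnn in lt_s.
Qed.

(** The coefficient is, up to sign, the sum of the principal minors of size j.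
    If the entries of M off the strictly upper triangular part of the blocks
    have positive order, then by card_moved_blocks each term in the expansion
    of the minor on J has at least as many factors of positive order as there
    are blocks met by J. *)
Lemma char_poly_coef_ord n q (M : 'M[X]_n) (beta : 'I_n -> 'I_q) (l j : nat) :
  (forall a b, ord_ge p 0 (M a b)) ->
  (forall a b, ~~ ((beta b == beta a) && (a < b)%N) -> ord_ge p 1 (M a b)) ->
  (j <= n)%N ->
  (forall J : {set 'I_n}, #|J| = j -> (l <= #|[set beta i | i in J]|)%N) ->
  ord_ge p l%:Z (char_poly M)`_(n - j).
Proof.
move=> M0 M1 le_j blocks; rewrite /char_poly /determinant coef_sum.
apply: ord_ge_sum => s _; rewrite mulr_sign.
suff: ord_ge p l%:Z (\prod_i char_poly_mx M i (s i))`_(n - j).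
  by case: (odd_perm s) => //; rewrite coefN => /ord_geN.
have -> : \prod_i char_poly_mx M i (s i)
   = \prod_i ((- M i (s i))%:P + 'X *+ (i == s i)).
  by apply: eq_bigr => i _; rewrite !mxE addrC polyCN.
(* J is the set of the rows in which the entry of M is chosen over 'X *)
rewrite bigA_distr coef_sum; apply: ord_ge_sum => J _.
rewrite (bigID (mem J)) /=.
rewrite (eq_bigr (fun i => (- M i (s i))%:P)); last by move=> i ->.
rewrite -rmorph_prod coefCM.
rewrite (eq_bigr (fun i => 'X *+ (i == s i))); last by move=> i /negPf ->.
have [/existsP[i /andP[iJ /negPf nsi]]|/existsPn fix_s] :=
  boolP [exists i, (i \notin J) && (i != s i)].
  rewrite [X in polyseq X](bigD1 i) //= nsi mulr0n mul0r coef0 mulr0.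
  exact: ord_ge0.
have {}fix_s i : i \notin J -> s i = i.
  by move=> iJ; have := fix_s i; rewrite iJ /= negbK => /eqP.
rewrite (eq_bigr (fun=> 'X)); last by move=> i /fix_s ->; rewrite eqxx.
rewrite prodr_const coefXn.
have [eq_j|] := eqVneq; last by rewrite mulr0 ord_ge0.
have cJ : #|J| = j.
  suff: (#|J| + (n - j) = n)%N by lia.
  by rewrite eq_j -[RHS]card_ord -(cardC (mem J)).
rewrite mulr1; pose bad i := ~~ ((beta (s i) == beta i) && (i < s i)%N).
apply: (@ord_geW _ _ _ _ (\sum_(i in J) nat_of_bool (bad i))%N%:Z).
  rewrite lez_nat (leq_trans (blocks J cJ)) //.
  apply: leq_trans (@card_moved_blocks _ _ beta s J bad fix_s _) _.
    by move=> i /negPn/andP[/eqP].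
  rewrite -sum1_card (big_mkcond (fun i => i \in [set _ in J | _])) /=.
  rewrite [X in (_ <= X)%N]big_mkcond; apply: leq_sum => i _.
  by rewrite inE; case: (i \in J) => //=; case: (bad i).
apply: ord_ge_prod => i _; apply: ord_geN.
by case: (boolP (bad i)) => //; apply: M1.
Qed.

(** This is the value at 1 of the characteristic polynomial of A, a monic
    polynomial whose other coefficients have positive order by
    char_poly_coef_ord with a single block. *)
Lemma ord_ge1_det1B n (A : 'M[X]_n) :
  (forall a b, ord_ge p 1 (A a b)) -> ord_ge p 1 (\det (1%:M - A) - 1).
Proof.
move=> A1.
have -> : \det (1%:M - A) = (char_poly A).[1].
  rewrite -[RHS]/(horner_eval 1 _) -det_map_mx; congr (\det _).
  apply/matrixP => i j; rewrite !mxE.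
  by rewrite /= /horner_eval hornerD hornerN hornerC hornerMn hornerX.
rewrite horner_coef size_char_poly big_ord_recr /= expr1n mulr1.
have := char_poly_monic A; rewrite monicE /lead_coef size_char_poly => /eqP /= ->.
rewrite addrK; apply: ord_ge_sum => i _; rewrite expr1n mulr1.
rewrite -(subKn (ltnW (ltn_ord i))).
apply: (@char_poly_coef_ord _ 1 _ (fun=> ord0) 1) => // [a b||J cJ].
- exact: ord_geW (A1 a b).
- exact: leq_subr.
rewrite card_gt0; apply/set0Pn.
have /card_gt0P[a aJ] : (0 < #|J|)%N by rewrite cJ subn_gt0.
by exists ord0; apply/imsetP; exists a.
Qed.

Lemma ord_ge1_unit y : ord_ge p 1 (y - 1) -> y != 0 /\ ord p y = 0.
Proof.
move=> y1; have n1 : ~~ ord_ge p 1 (1 : X) by rewrite /ord_ge oner_eq0 ord_one.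
have ny : ~~ ord_ge p 1 y.
  apply: contra n1 => yp; rewrite -(subKr y 1); apply: ord_geD => //.
  exact: ord_geN.
have : ord_ge p 0 y.
  rewrite -(subrK 1 y); apply: ord_geD; last exact: ord_ge1.
  exact: ord_geW y1.
move: ny; rewrite /ord_ge; case: eqVneq => //= _.
by rewrite -ltNge => h1 h2; split=> //; lia.
Qed.

End CharPolyValuation.

Section CharPolyBasis.
Context (K : fieldType) (V : vectType K) (f : 'End(V)).

Lemma char_poly_similar n (A B P Q : 'M[K]_n) :
  P *m Q = 1%:M -> A *m P = P *m B -> char_poly A = char_poly B.
Proof.
move=> PQ AP; have detP : \det (map_mx polyC P) != 0.
  have := congr1 determinant PQ; rewrite det_mulmx det1 det_map_mx polyC_eq0.
  by move/eqP; apply: contraTneq => ->; rewrite mul0r eq_sym oner_eq0.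
apply: (mulIf detP); rewrite [RHS]mulrC /char_poly -!det_mulmx; congr (\det _).
by rewrite mulmxBl mulmxBr -!map_mxM AP scalar_mxC.
Qed.

Lemma char_poly_basis n (v : n.-tuple V) :
  let e := vbasis {:V} in basis_of fullv v ->
  char_poly (passmx.mxof e e f) = char_poly (\matrix_(i, j) coord v j (f v`_i)).
Proof.
move=> e bv; have dimV := size_basis bv.
case: n / dimV in v bv *.
have be : basis_of fullv e := vbasisP _.
have -> : \matrix_(i, j) coord v j (f v`_i) = passmx.mxof v v f.
  by apply/matrixP => i j; rewrite !mxE /= passmx.vecof_delta.
apply: (@char_poly_similar _ _ _ (passmx.mxof e v \1) (passmx.mxof v e \1)).
  by rewrite -passmx.mxof_comp // comp_lfun1l passmx.mxof1 // (basis_free be).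
by rewrite -!passmx.mxof_comp // comp_lfun1l comp_lfun1r.
Qed.

End CharPolyBasis.

(** * The stalk of a bundle at the marked point *)

Section Lattice.
Context (k : closedFieldType) (X : curve k) (x : closed_point X) (t : X).
Context (ordt : ord x t = 1).

Lemma uniformizer_neq0 : t != 0.
Proof. by apply/eqP => t0; move: ordt; rewrite t0 Defs.ord0. Qed.

Lemma ord_uniformizerX n : ord x (t ^+ n) = n%:Z.
Proof.
elim: n => [|n IH]; first by rewrite expr0 ord_one.
by rewrite exprS ordM ?expf_neq0 ?uniformizer_neq0 // IH ordt -intS.
Qed.

Lemma ord_ge_expansion y c n :
  is_expansion x t y c -> has_valuation c n -> ~~ ord_ge x n.+1%:Z y.
Proof.
move=> /(_ n.+1) exp_y [c0 cn]; apply/negP => y_ge.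
have : ord_ge x n.+1%:Z (kconst X (c n) * t ^+ n).
  rewrite -[X in ord_ge _ _ X](subKr y); apply: ord_geD => //; apply: ord_geN.
  move: exp_y; rewrite big_ord_recr big1 /= ?add0r // => i _.
  by rewrite c0 // rmorph0 mul0r.
rewrite /ord_ge mulf_eq0 fmorph_eq0 (negPf cn) expf_eq0.
rewrite (negPf uniformizer_neq0) andbF /= ordM ?fmorph_eq0 //; last first.
  by rewrite expf_neq0 ?uniformizer_neq0.
by rewrite ordC ord_uniformizerX add0r lez_nat ltnn.
Qed.

(** With respect to dt/t, regular sections of omega_X(x) at x have regular
    coefficients, because a regular differential form is a regular multiple
    of dt.  Consequently the Higgs field preserves the stalk at x. *)
Lemma logomega_gen_ord_ge (Om : differentials X) l :
  logomega_gen Om x t x l -> ord_ge x 0 l.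
Proof.
case=> l0 /(_ l) [_ sect_l].
have [|l' [l'0 gen] ord_l] := sect_l; first by rewrite divff // ord_ge1.
(* otherwise (l' / t) dt = 0 would be regular, and so would be 1 / t *)
have dt0 : dif Om t != 0.
  apply/eqP => dt0; have := (gen (l' / t)).1; rewrite dt0 scaler0.
  have /[swap]/[apply] : regular_form x (0 : Om).
    by move=> s _; exists 0; [apply: ord_ge0 | rewrite scale0r].
  rewrite mulrAC divff // mul1r /ord_ge invr_eq0 (negPf uniformizer_neq0) /=.
  by rewrite ordV ?uniformizer_neq0 // ordt.
have l'_ge : ord_ge x 0 l'.
  have := (gen l').2; rewrite divff // => /(_ (ord_ge1 _)) /(_ t ordt) [h h0].
  move/eqP; rewrite -subr_eq0 -scalerBl scaler_eq0 (negPf dt0) orbF subr_eq0.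
  by move/eqP => ->.
have -> : l = (l * t ^ (- 1) / l' ^ 1) * (l' * t).
  by rewrite expr1z mulrA divfK // exprN1 divfK // uniformizer_neq0.
rewrite eqxx in ord_l; rewrite (_ : 0 = - 1 + (0 + 1)) //.
apply: ord_geM => //.
by apply: ord_geM => //; rewrite /ord_ge ordt lexx orbT.
Qed.

Context (r : nat) (E : bundle X r).
Implicit Types (u : gfib E).

Lemma frame_at :
  exists e : r.-tuple (gfib E), is_frame (@stalk _ _ _ E) x fullv e.
Proof.
by have [S [e [xS fr]]] := bundle_trivial E x; exists e; apply: fr.
Qed.

Lemma stalkE (e : r.-tuple (gfib E)) u : is_frame (@stalk _ _ _ E) x fullv e ->
  stalk x u <-> forall i, ord_ge x 0 (coord e i u).
Proof. by case=> _; apply; apply: memvf. Qed.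

Lemma stalk0 : stalk x (0 : gfib E).
Proof.
have [e fr] := frame_at; apply/(stalkE _ fr) => i.
by rewrite linear0 ord_ge0.
Qed.

Lemma stalkD u v : stalk x u -> stalk x v -> stalk x (u + v).
Proof.
have [e fr] := frame_at => /(stalkE _ fr) su /(stalkE _ fr) sv.
apply/(stalkE _ fr) => i; rewrite linearD.
by apply: ord_geD; [apply: su | apply: sv].
Qed.

Lemma stalkZ y u : ord_ge x 0 y -> stalk x u -> stalk x (y *: u).
Proof.
have [e fr] := frame_at => y0 /(stalkE _ fr) su.
apply/(stalkE _ fr) => i; rewrite linearZ -[0]addr0.
by apply: ord_geM => //; apply: su.
Qed.

Lemma stalkN u : stalk x u -> stalk x (- u).
Proof.
by rewrite -scaleN1r; apply: stalkZ; apply: ord_geN; apply: ord_ge1.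
Qed.

Lemma stalk_sum (I : finType) (v : I -> gfib E) :
  (forall i, stalk x (v i)) -> stalk x (\sum_i v i).
Proof.
by move=> sv; elim/big_ind: _ => // [|u w]; [apply: stalk0|apply: stalkD].
Qed.

Context (Fx : vectType k) (ev : gfib E -> Fx) (ev_fib : is_fibre x t ev).

Lemma ev_scale c u : stalk x u -> ev (kconst X c *: u) = c *: ev u.
Proof.
by case: ev_fib => _ evZ _ _; apply: evZ; rewrite subrr ord_ge0.
Qed.

Lemma evB u v : stalk x u -> stalk x v -> ev (u - v) = ev u - ev v.
Proof.
case: ev_fib => evD _ _ _ su sv; rewrite evD //; last exact: stalkN.
congr (_ + _); rewrite -scaleN1r -(rmorph1 (kconst X)) -rmorphN ev_scale //.
by rewrite scaleN1r.
Qed.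

Lemma ev_sum n (c : 'I_n -> k) (v : 'I_n -> gfib E) :
  (forall i, stalk x (v i)) ->
  ev (\sum_i kconst X (c i) *: v i) = \sum_i c i *: ev (v i).
Proof.
case: ev_fib => evD _ _ _ sv.
pose P u w := stalk x u /\ ev u = w.
suff [] : P (\sum_i kconst X (c i) *: v i) (\sum_i c i *: ev (v i)) by [].
elim/big_ind2: _ => [|u w u' w' [su <-] [su' <-]|i _].
- split; first exact: stalk0.
  rewrite -[X in ev X](scale0r 0) -(rmorph0 (kconst X)).
  by rewrite ev_scale ?scale0r //; apply: stalk0.
- by split; [apply: stalkD | apply: evD].
- by split; [apply: stalkZ => //; apply: ord_geC | apply: ev_scale].
Qed.

(** Nakayama's lemma, with determinants: a frame e at x satisfies e = C v + B e,
    where C has entries in k and B has entries in the maximal ideal.  If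
    v = G e, then C G = 1 - B has unit determinant, hence so has G. *)
Lemma lift_frame (w : r.-tuple Fx) (v : r.-tuple (gfib E)) :
  basis_of fullv w -> (forall i : 'I_r, stalk x v`_i /\ ev v`_i = w`_i) ->
  basis_of fullv v /\
  (forall u, stalk x u -> forall i, ord_ge x 0 (coord v i u)).
Proof.
move=> bw vw; have [e fr] := frame_at; have [be _] := fr.
have se u := stalkE u fr.
have sej (j : 'I_r) : stalk x e`_j.
  by apply/se => i; rewrite coord_free ?(basis_free be) //; case: eqP => _;
    [apply: ord_ge1 | apply: ord_ge0].
pose C : 'M[X]_r := \matrix_(j, i) kconst X (coord w i (ev e`_j)).
pose G : 'M[X]_r := \matrix_(i, j) coord e j v`_i.
pose rem (j : 'I_r) := e`_j - \sum_i C j i *: v`_i.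
have srem j : stalk x (t^-1 *: rem j).
  case: ev_fib => _ _ _ ev0; apply/ev0.
    apply: stalkD => //; apply: stalkN; apply: stalk_sum => i.
    by apply: stalkZ; [rewrite mxE; apply: ord_geC | case: (vw i)].
  rewrite evB //; last first.
    apply: stalk_sum => i.
    by apply: stalkZ; [rewrite mxE; apply: ord_geC | case: (vw i)].
  under eq_bigr => i _ do rewrite mxE.
  rewrite ev_sum; last by move=> i; case: (vw i).
  rewrite [X in X - _](coord_basis bw (memvf _)); apply/eqP; rewrite subr_eq0.
  by apply/eqP; apply: eq_bigr => i _; case: (vw i) => _ ->.
pose B : 'M[X]_r := \matrix_(j, i) coord e i (rem j).
have B1 a b : ord_ge x 1 (B a b).
  have := (se _).1 (srem a) b; rewrite linearZ /= mxE => tr.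
  rewrite -[coord _ _ _](mulVKf uniformizer_neq0) -[1]addr0.
  by apply: ord_geM => //; rewrite /ord_ge ordt lexx orbT.
have CG : C *m G = 1%:M - B.
  apply/matrixP => a b; rewrite !mxE linearB /= coord_free ?(basis_free be) //.
  rewrite [a == b]eq_sym opprB addrC subrK linear_sum.
  by apply: eq_bigr => i _; rewrite linearZ !mxE.
have C0 a b : ord_ge x 0 (C a b) by rewrite mxE; apply: ord_geC.
have G0 a b : ord_ge x 0 (G a b) by rewrite mxE; case: (vw a) => /se.
have [dCG ordCG] := ord_ge1_unit (ord_ge1_det1B B1).
rewrite -CG det_mulmx in dCG ordCG.
have detG0 : \det G != 0 by apply: contraNneq dCG => ->; rewrite mulr0.
have detC0 : \det C != 0 by apply: contraNneq dCG => ->; rewrite mul0r.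
rewrite ordM // in ordCG.
have invdetG : ord_ge x 0 (\det G)^-1.
  have := ord_ge_det C0; have := ord_ge_det G0.
  rewrite /ord_ge invr_eq0 (negPf detG0) (negPf detC0) /= ordV // => _.
  by move/eqP: ordCG; rewrite addr_eq0 => /eqP <-.
have Gu : G \in unitmx by rewrite unitmxE unitfE.
have H0 a b : ord_ge x 0 (invmx G a b).
  rewrite /invmx Gu !mxE -[0]addr0; apply: ord_geM => //.
  rewrite /cofactor -[0]addr0; apply: ord_geM.
    by rewrite -signr_odd; case: odd; [apply: ord_geN|]; apply: ord_ge1.
  by apply: ord_ge_det => i j; rewrite 2!mxE; apply: G0.
have ev_e (j : 'I_r) : e`_j = \sum_i invmx G j i *: v`_i.
  transitivity (\sum_l (invmx G *m G) j l *: e`_l).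
    rewrite mulVmx // (bigD1 j) //= mxE eqxx scale1r big1 ?addr0 // => l /negPf.
    by rewrite mxE eq_sym => ->; rewrite scale0r.
  under eq_bigr => l _ do rewrite mxE scaler_suml.
  rewrite exchange_big; apply: eq_bigr => i _ /=.
  rewrite [v`_i in RHS](coord_basis be (memvf _)) scaler_sumr.
  by apply: eq_bigr => l _; rewrite scalerA mxE.
have bv : basis_of fullv v.
  rewrite basisEdim size_tuple (bundle_rank E) leqnn andbT -(span_basis be).
  apply/span_subvP => u /(nthP 0)[j]; rewrite size_tuple => lt_j <-.
  rewrite (ev_e (Ordinal lt_j)); apply: memv_suml => i _; apply: memvZ.
  by apply: memv_span; apply: mem_nth; rewrite size_tuple.
split=> // u /se su i.
rewrite [u](coord_basis be (memvf _)).
under eq_bigr => j _ do rewrite (ev_e j).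
rewrite linear_sum; apply: ord_ge_sum => j _.
rewrite linearZ linear_sum -[0]addr0; apply: ord_geM => //.
apply: ord_ge_sum => l _; rewrite linearZ -[0]addr0; apply: ord_geM => //.
by rewrite /= coord_free ?(basis_free bv) //; case: eqP => _;
    [apply: ord_ge1 | apply: ord_ge0].
Qed.

End Lattice.

(** * The Jordan type of the residue of a Higgs field *)

Section HiggsJordan.
Context (k : closedFieldType) (X : curve k) (Om : differentials X).
Context (x : closed_point X) (t : X) (r : nat) (m : seq nat).
Context (ordt : ord x t = 1) (H : higgs Om x t r m).

Lemma hmap_stalk v : stalk x v -> stalk x (hmap H v).
Proof.
move=> /hmap_regular[l genl sl].
have l0 : l != 0 by case: genl.
rewrite -[hmap H v](scalerKV l0); apply: stalkZ => //.
exact: logomega_gen_ord_ge genl.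
Qed.

(** In a lift of a Jordan basis of hres H to the stalk at x, the matrix of
    hmap H is congruent to the Jordan matrix modulo t.  By char_poly_coef_ord,
    the order of a_j is at least the number of blocks needed to hold j
    indices, which exceeds l when the l largest blocks have fewer than j
    indices in total. *)
Lemma hitchin_ord_ge cs (l j : nat) :
  is_jordan_basis (hres H) fullv cs -> sumn [seq c.1 | c <- cs] = r ->
  sorted geq [seq c.1 | c <- cs] ->
  (0 < j <= r)%N -> (partial_sum [seq c.1 | c <- cs] l < j)%N ->
  ord_ge x l.+1%:Z (hitchin H)`_j.-1.
Proof.
move=> jb sum_s srt /andP[j_gt0 le_j] lt_j.
set s := [seq c.1 | c <- cs] in sum_s srt lt_j *.
set W := flatten [seq jordan_chain (hres H) c | c <- cs].
have size_W : size W == r by rewrite size_jordan_chains -/s sum_s.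
pose w := Tuple size_W.
have bw : basis_of fullv w by case: jb.
have fib := ev_fibre H.
have lift (i : 'I_r) : exists u, stalk x u /\ ev u = w`_i.
  by case: fib => _ _ /(_ w`_i)[u su <-] _; exists u.
have [v0 v0w] := fin_all_exists lift.
pose v := [tuple v0 i | i < r].
have vE (i : 'I_r) : v`_i = v0 i by rewrite -tnth_nth tnth_mktuple.
have [|bv int_v] := lift_frame ordt fib bw (v := v).
  by move=> i; rewrite vE.
pose M := \matrix_(i, j < r) coord v j (hmap H v`_i).
have sv i : stalk x (hmap H (v0 i)) by apply: hmap_stalk; case: (v0w i).
have s_v0 i : stalk x (v0 i) by case: (v0w i).
have lt_is (i : 'I_r) : (i < sumn s)%N by rewrite sum_s.
pose beta (i : 'I_r) : 'I_(size s) := Ordinal (reshape_indexP (lt_is i)).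
have M0 a b : ord_ge x 0 (M a b) by rewrite mxE vE; apply: int_v.
have coord1 u i : stalk x u -> ev u = 0 -> ord_ge x 1 (coord v i u).
  move=> su; case: fib => _ _ _ /(_ u su) -> /int_v /(_ i).
  rewrite linearZ /= => ge0.
  rewrite -[coord _ _ _](mulVKf (uniformizer_neq0 ordt)) -[1]addr0.
  by apply: ord_geM => //; rewrite /ord_ge ordt lexx orbT.
have evh (i : 'I_r) : ev (hmap H (v0 i)) = hres H w`_i.
  by rewrite -hres_induced //; case: (v0w i) => _ ->.
have M1 a b : ~~ ((beta b == beta a) && (a < b)%N) -> ord_ge x 1 (M a b).
  move=> nab; rewrite mxE vE.
  have [Nw0|[lt_a1 blk Nw]] := jordan_basis_step jb (lt_is a).
    by apply: coord1 => //; rewrite evh.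
  rewrite -/s in lt_a1 blk; rewrite sum_s in lt_a1; pose a1 := Ordinal lt_a1.
  rewrite -[hmap H _](subrK v`_a1) linearD; apply: ord_geD.
    apply: coord1; first by apply: stalkD => //; apply: stalkN; rewrite vE.
    rewrite (evB fib) ?vE // evh Nw; case: (v0w a1) => _ ->; exact: subrr.
  rewrite -[X in ord_ge _ _ X]/(coord v b v`_a1) coord_free ?(basis_free bv) //.
  case: eqP => [a1b|_]; last exact: ord_ge0.
  by case/negP: nab; rewrite -a1b -(inj_eq val_inj) /= blk eqxx ltnSn.
have -> : (hitchin H)`_j.-1 = (char_poly M)`_(r - j).
  have lt_j1 : (j.-1 < r)%N by rewrite prednK.
  rewrite -(tnth_nth 0 (hitchin H) (Ordinal lt_j1)) tnth_mktuple /= prednK //.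
  by rewrite -(char_poly_basis _ bv).
apply: (char_poly_coef_ord (beta := beta)) => // J cJ.
rewrite ltnNge; apply/negP => leJ; move: lt_j; rewrite ltnNge => /negP; apply.
rewrite -cJ; apply: leq_trans (sum_parts_le srt leJ).
exact: card_le_blocks.
Qed.

End HiggsJordan.

Theorem corollary4p15 (k : closedFieldType) (X : curve k)
    (Om : differentials X) (g : nat) (x : closed_point X) (t : X) (r : nat)
    (m : seq nat) (d : int) (R : realType) (alpha : 'I_(size m) -> R) :
  is_genus Om g -> (2 <= g)%N ->
  (1 <= r)%N -> (2%N \in [pchar k] -> (3 <= r)%N) ->
  ord x t = 1 ->
  all (leq 1) m -> sumn m = r ->
  is_weights alpha -> is_generic Om x t r alpha d ->
  forall a : r.-tuple X, in_U Om x t (conj_partition m) a ->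
  forall H : higgs Om x t r m,
    hdegree H = d -> stable alpha H -> hitchin H = a ->
    nilpotent_jordan_blocks (hres H) (conj_partition m).
Proof.
move=> _ _ _ _ ordt _ sum_m _ _ a [_ [b [exp_b val_b _]] _ _] H _ _ hit_a.
set mu := conj_partition m in val_b *.
have sum_mu : sumn mu = r by rewrite sumn_conj_partition.
have nilH := parabolic_nilpotent (flag0 H) (flag_size H)
  (@hres_strongly_parabolic _ _ _ _ _ _ _ H).
have [|cs0 jb0] := jordan_basis_exists (N := hres H) (W := fullv) (n := size m)
  (subvf _); first by move=> w _; apply: nilH.
have [cs jb srt] := jordan_basis_sort jb0.
set s := [seq c.1 | c <- cs] in srt.
have sum_s : sumn s = r.
  rewrite -sum_m -(parabolic_dim (flag_size H) (@flag_dim _ _ _ _ _ _ _ H)) flag0.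
  have [_ bas _] := jb.
  by rewrite -(size_jordan_chains (hres H)) -(size_basis (X := in_tuple _) bas).
suff -> : mu = s by apply: nilpotent_jordan_blocksP.
apply/esym/eq_partition_of_partial_sums.
- by case: jb => pos _ _; rewrite all_map.
- exact: conj_partition_gt0.
- by rewrite sum_s.
case=> [|l] lt_l; first by rewrite /partial_sum !take0.
apply/eqP; rewrite eqn_leq; apply/andP; split.
  (* beyond (l + 1) mu`_l, the sum for nu bounds the rank of N^(mu`_l) from
     below and the sum for mu bounds it from above *)
  rewrite partial_sum_conj //; apply: leq_trans (sumn_take_le _ _ (nth 0%N mu l)) _.
  rewrite leq_add2l -map_comp.
  apply: leq_trans (jordan_basis_rank_ge (nth 0%N mu l) jb) _.
  rewrite nth_conj_partition // -(flag0 H).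
  apply: parabolic_rank_le; [exact: flag_size | exact: flag_sub | exact: flag_dim
    | exact: hres_strongly_parabolic].
(* the coefficient a_j has order exactly gamma_j = l + 1 at x *)
set j := partial_sum mu l.+1; rewrite leqNgt; apply/negP => lt_j.
have jr : (0 < j <= r)%N.
  rewrite (leq_ltn_trans (leq0n _) lt_j) /= -sum_mu.
  rewrite -[X in (_ <= sumn X)%N](take_size mu).
  exact: leq_partial_sum.
have gj : gamma mu j = l.+1.
  apply/gammaP; rewrite ?sum_mu //; split=> //=.
  rewrite /j partial_sum_rcons // -[X in (X < _)%N]addn0 ltn_add2l.
  exact: (all_nthP 0%N (conj_partition_gt0 m)).
have [j_gt0 le_j] := andP jr.
have := hitchin_ord_ge ordt jb sum_s srt jr lt_j.
rewrite hit_a; apply/negP.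
have -> : a`_j.-1 = (1 :: a)`_j by case: (j) j_gt0.
by apply: (ord_ge_expansion ordt) (exp_b _ le_j) _; rewrite -gj; apply: val_b.
Qed.
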